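(* Let $A\in\mathbb{R}^{n\times n}$, $B\in\mathbb{R}^{n\times m}$, $C\in\mathbb{R}^{p\times n}$, $D\in\mathbb{R}^{p\times m}$ with $(A,B)$ controllable and $(A,C)$ observable, and consider the linear system $\dot x=Ax+Bu$, $y=Cx+Dw$ with disturbance $w\in\mathbb{R}^m$. Let $Q=Q^T\ge 0$ ($n\times n$) and $R=R^T>0$ ($m\times m$) be such that the pair $(A,\sqrt{Q})$ is observable. For matrices $F\in\mathbb{R}^{m\times p}$, $P=P^T$, $R=R^T>0$, $Q=Q^T$ consider the matrix inequality $$\left[\begin{array}{cc} Q-PBFC-C^TF^TB^TP+N & P\overline B\\ \overline B^TP & R\end{array}\right]>0, \qquad (\ast)$$ where $$N=PB(FDR^{-1}+R^{-1}D^TF^T)B^TP,\qquad \overline B=B(I_m+FD).$$ (Sufficiency) Let $P$ be the unique positive definite solution of the Riccati equation $-A^TP-PA+PBR^{-1}B^TP=Q$. If there is a matrix $F$ satisfying $(\ast)$ with these $P,Q,R$, then the control law $u=Fy$ is a stabilizing static output feedback for the system in the absence of disturbances ($w=0$), and the closed-loop system is quadratically dissipative with supply rate $W(w)=w^TRw$. (Converse) If the system is static output feedback stabilizable in the absence of disturbances and quadratically dissipative with supply rate $W(w)=w^TRw$, then there always exist $F$, $P>0$, $R>0$, $Q$ satisfying $(\ast)$.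
   Context: Matrix inequalities $>0,\ \ge 0$ denote positive definiteness and positive semidefiniteness of symmetric matrices; $\sqrt{Q}$ is the symmetric positive semidefinite square root of $Q$. With $u=Fy=FCx+FDw$ the closed-loop system is $\dot x=(A+BFC)x+BFDw$. The feedback $u=Fy$ is stabilizing in the absence of disturbances if $\dot x=(A+BFC)x$ is asymptotically (equivalently, exponentially) stable. A system with state $x$ and disturbance $w$ is dissipative with supply rate $W(w)$ and $C^1$ storage function $V(x)$ if $V$ is positive definite and $\dot V(x(t))<W(w(t))$ along the trajectories of the system, i.e. $\nabla V(x)^T\dot x<W(w)$ for all $(x,w)\neq(0,0)$. It is quadratically dissipative when both $V$ and $W$ are quadratic functions (so $V(x)=x^TPx$ with $P=P^T>0$). The hypothesis of the converse means that there is a static output feedback $u=Fy$ for which the closed-loop system is asymptotically stable when $w=0$ and quadratically dissipative with supply rate $w^TRw$. *)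

(* Defs.v *)
From HB Require Import structures.
From mathcomp Require Import all_boot all_order all_algebra.
From mathcomp Require Import all_classical all_reals all_analysis.

Set Implicit Arguments.
Unset Strict Implicit.
Unset Printing Implicit Defensive.

Import Order.TTheory GRing.Theory Num.Theory.
Import numFieldNormedType.Exports.

Local Open Scope classical_set_scope.
Local Open Scope ring_scope.

Definition qform (K : realType) (n : nat) (M : 'M[K]_n) (x : 'cV[K]_n) : K :=
  (x^T *m M *m x) 0 0.

Definition posdefmx (K : realType) (n : nat) (M : 'M[K]_n) : Prop :=
  M^T = M /\ forall x : 'cV[K]_n, x != 0 -> 0 < qform M x.

Definition possemidefmx (K : realType) (n : nat) (M : 'M[K]_n) : Prop :=
  M^T = M /\ forall x : 'cV[K]_n, 0 <= qform M x.

(* A positive semidefinite Q has exactly one such S. *)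
Definition is_sqrtmx (K : realType) (n : nat) (S Q : 'M[K]_n) : Prop :=
  possemidefmx S /\ S *m S = Q.

(* x'(t) = f t (x t) for t > 0, with x continuous on [0, +oo[ ; this avoids a
   one-sided derivative at 0, and the values x t for t < 0 are irrelevant. *)
Definition trajectory (K : realType) (n : nat)
    (f : K -> 'cV[K]_n -> 'cV[K]_n) (x : K -> 'cV[K]_n) : Prop :=
  {within `[0, +oo[, continuous x} /\
  forall t : K, 0 < t -> is_derive t 1 x (f t (x t)).

(* Continuous inputs suffice: for a linear time-invariant system they reach the
   same states as piecewise continuous or locally integrable ones. *)
Definition controllable (K : realType) (n m : nat)
    (A : 'M[K]_n) (B : 'M[K]_(n, m)) : Prop :=
  forall x0 x1 : 'cV[K]_n, exists T : K, 0 < T /\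
    exists (u : K -> 'cV[K]_m) (x : K -> 'cV[K]_n),
      [/\ continuous u, trajectory (fun t z => A *m z + B *m u t) x,
          x 0 = x0 & x T = x1].

Definition observable (K : realType) (n p : nat)
    (A : 'M[K]_n) (C : 'M[K]_(p, n)) : Prop :=
  forall x1 x2 : K -> 'cV[K]_n,
    trajectory (fun _ z => A *m z) x1 -> trajectory (fun _ z => A *m z) x2 ->
    (forall t : K, 0 <= t -> C *m x1 t = C *m x2 t) ->
    x1 0 = x2 0.

Definition asymptotically_stable (K : realType) (n : nat) (M : 'M[K]_n) : Prop :=
  (forall e : K, 0 < e -> exists2 d : K, 0 < d &
     forall x : K -> 'cV[K]_n, trajectory (fun _ z => M *m z) x ->
       `|x 0| < d -> forall t : K, 0 <= t -> `|x t| < e) /\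
  (forall x : K -> 'cV[K]_n, trajectory (fun _ z => M *m z) x ->
     x t @[t --> +oo] --> (0 : 'cV[K]_n)).

Definition positive_definite_fun (K : realType) (n : nat)
    (V : 'cV[K]_n -> K) : Prop :=
  V 0 = 0 /\ forall x : 'cV[K]_n, x != 0 -> 0 < V x.

Definition C1_fun (K : realType) (n : nat) (V : 'cV[K]_n -> K) : Prop :=
  (forall x : 'cV[K]_n, differentiable V x) /\
  forall v : 'cV[K]_n, continuous (fun x : 'cV[K]_n => 'd V x v).

(* 'd V x (f x w) is the product of the gradient of V at x with x' = f x w. *)
Definition dissipative (K : realType) (n m : nat)
    (f : 'cV[K]_n -> 'cV[K]_m -> 'cV[K]_n)
    (W : 'cV[K]_m -> K) (V : 'cV[K]_n -> K) : Prop :=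
  [/\ C1_fun V, positive_definite_fun V &
      forall (x : 'cV[K]_n) (w : 'cV[K]_m), ~ (x = 0 /\ w = 0) ->
        'd V x (f x w) < W w].

Definition quadratic_fun (K : realType) (n : nat) (V : 'cV[K]_n -> K) : Prop :=
  exists P : 'M[K]_n, P^T = P /\ V = qform P.

Definition quadratically_dissipative (K : realType) (n m : nat)
    (f : 'cV[K]_n -> 'cV[K]_m -> 'cV[K]_n) (W : 'cV[K]_m -> K) : Prop :=
  quadratic_fun W /\
  exists V : 'cV[K]_n -> K, quadratic_fun V /\ dissipative f W V.

(* The feedback u = F (C x + D w) substituted into x' = A x + B u. *)
Definition closed_loop (K : realType) (n m p : nat)
    (A : 'M[K]_n) (B : 'M[K]_(n, m)) (C : 'M[K]_(p, n)) (D : 'M[K]_(p, m))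
    (F : 'M[K]_(m, p)) (x : 'cV[K]_n) (w : 'cV[K]_m) : 'cV[K]_n :=
  (A + B *m F *m C) *m x + B *m F *m D *m w.

Definition stabilizing (K : realType) (n m p : nat)
    (A : 'M[K]_n) (B : 'M[K]_(n, m)) (C : 'M[K]_(p, n))
    (F : 'M[K]_(m, p)) : Prop :=
  asymptotically_stable (A + B *m F *m C).

Definition lmi_N (K : realType) (n m p : nat)
    (B : 'M[K]_(n, m)) (D : 'M[K]_(p, m)) (F : 'M[K]_(m, p))
    (P : 'M[K]_n) (R : 'M[K]_m) : 'M[K]_n :=
  P *m B *m (F *m D *m invmx R + invmx R *m D^T *m F^T) *m B^T *m P.

Definition lmi_Bbar (K : realType) (n m p : nat)
    (B : 'M[K]_(n, m)) (D : 'M[K]_(p, m)) (F : 'M[K]_(m, p)) : 'M[K]_(n, m) :=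
  B *m (1%:M + F *m D).

Definition lmi_mx (K : realType) (n m p : nat)
    (B : 'M[K]_(n, m)) (C : 'M[K]_(p, n)) (D : 'M[K]_(p, m))
    (F : 'M[K]_(m, p)) (P Q : 'M[K]_n) (R : 'M[K]_m) : 'M[K]_(n + m) :=
  block_mx
    (Q - P *m B *m F *m C - C^T *m F^T *m B^T *m P + lmi_N B D F P R)
    (P *m lmi_Bbar B D F)
    ((lmi_Bbar B D F)^T *m P)
    R.

(* Main.v *)
(** With [w] shifted by a linear function of [x], the quadratic form of the
    block matrix becomes [w^T R w] minus the derivative of [x^T P x] along the
    closed loop, as soon as [Q] is the Riccati expression of [P].  Hence the
    matrix inequality is equivalent to strict dissipativity with storage
    [x^T P x].  Setting [w = 0]
    makes [x^T P x] a strict Lyapunov function, which gives stability.  In the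
    converse, [P] is the matrix of the given storage function and the free
    matrix [Q] is chosen so that the Riccati equation holds. *)

Require Import Defs.
From HB Require Import structures.
From mathcomp Require Import all_boot all_order all_algebra.
From mathcomp Require Import all_classical all_reals all_analysis.
From mathcomp Require Import ring lra.

Set Implicit Arguments.
Unset Strict Implicit.
Unset Printing Implicit Defensive.

Import Order.TTheory GRing.Theory Num.Theory.
Import numFieldNormedType.Exports.

Local Open Scope ring_scope.

(** * Bilinear and quadratic forms of matrices *)

Section BilinearForm.
Variable K : realType.

(** Rectangular matrices are allowed so that off-diagonal blocks are covered. *)
Definition bform n m (M : 'M[K]_(n, m)) (x : 'cV[K]_n) (y : 'cV[K]_m) : K :=
  (x^T *m M *m y) 0 0.

Lemma bformDl n m (M : 'M[K]_(n, m)) x y z :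
  bform M (x + y) z = bform M x z + bform M y z.
Proof. by rewrite /bform linearD /= !mulmxDl mxE. Qed.

Lemma bformDr n m (M : 'M[K]_(n, m)) x y z :
  bform M z (x + y) = bform M z x + bform M z y.
Proof. by rewrite /bform mulmxDr mxE. Qed.

Lemma bformNl n m (M : 'M[K]_(n, m)) x z : bform M (- x) z = - bform M x z.
Proof. by rewrite /bform linearN /= !mulNmx mxE. Qed.

Lemma bformNr n m (M : 'M[K]_(n, m)) x z : bform M z (- x) = - bform M z x.
Proof. by rewrite /bform mulmxN mxE. Qed.

Lemma bformDm n m (M N : 'M[K]_(n, m)) x y :
  bform (M + N) x y = bform M x y + bform N x y.
Proof. by rewrite /bform mulmxDr mulmxDl mxE. Qed.

Lemma bformNm n m (M : 'M[K]_(n, m)) x y : bform (- M) x y = - bform M x y.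
Proof. by rewrite /bform mulmxN mulNmx mxE. Qed.

(** A 1 by 1 matrix equals its transpose. *)
Lemma bform_tr n m (M : 'M[K]_(n, m)) x y : bform M^T x y = bform M y x.
Proof.
rewrite /bform -[in RHS](trmxK (y^T *m M *m x)) [in RHS]mxE.
by rewrite !trmx_mul trmxK mulmxA.
Qed.

Lemma bformE n m (M : 'M[K]_(n, m)) x y :
  bform M x y = \sum_j \sum_i M i j * (x i 0 * y j 0).
Proof.
rewrite /bform mxE; apply: eq_bigr => j _.
rewrite mxE mulr_suml; apply: eq_bigr => i _.
by rewrite mxE mulrCA mulrA.
Qed.

Lemma qform_bform n (M : 'M[K]_n) x : qform M x = bform M x x.
Proof. by []. Qed.

Lemma qformN n (M : 'M[K]_n) x : qform (- M) x = - qform M x.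
Proof. exact: bformNm. Qed.

Lemma qformZ n (M : 'M[K]_n) a x : qform M (a *: x) = a ^+ 2 * qform M x.
Proof.
by rewrite /qform [(a *: x)^T]linearZ -!scalemxAl -scalemxAr !mxE mulrA expr2.
Qed.

Lemma qform0 n (M : 'M[K]_n) : qform M 0 = 0.
Proof. by rewrite /qform mulmx0 mxE. Qed.

Lemma qform_block n m (M11 : 'M[K]_n) (M12 : 'M[K]_(n, m)) M21 M22 x z :
  qform (block_mx M11 M12 M21 M22) (col_mx x z) =
  qform M11 x + bform M12 x z + bform M21 z x + qform M22 z.
Proof.
rewrite /qform tr_col_mx mul_row_block mul_row_col !mulmxDl.
by rewrite mxE [X in X + _]mxE [X in _ + X]mxE addrACA addrA.
Qed.

(** A nonzero row of the kernel, once transposed, would be a nonzero zero of the form. *)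
Lemma posdefmx_unit n (M : 'M[K]_n) : posdefmx M -> M \in unitmx.
Proof.
move=> [_ Mpos]; rewrite -row_free_unit -kermx_eq0.
apply/eqP/row_matrixP => i; rewrite row0.
have : (row i (kermx M)) *m M = 0 by rewrite -row_mul mulmx_ker row0.
set u := row i _ => uM; apply: contrapT => /eqP u0.
have /Mpos : u^T != 0 by rewrite -trmx0 (inj_eq trmx_inj).
by rewrite /qform trmxK uM mul0mx mxE ltxx.
Qed.

End BilinearForm.

(** * Differentiation of quadratic forms *)

Section QuadraticFormCalculus.
Variables (K : realType) (n : nat).
Implicit Types (M : 'M[K]_n) (x v : 'cV[K]_n).

Lemma is_diff_sum (V : normedModType K) (I : finType) (f df : I -> V -> K)
    (z : V) :
  (forall i, is_diff z (f i) (df i)) ->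
  is_diff z (fun y : V => \sum_i f i y) (fun y : V => \sum_i df i y).
Proof.
move=> fdf.
have sumE (h : I -> V -> K) : (fun y : V => \sum_i h i y) = \sum_i h i.
  by apply/funext => y; rewrite fct_sumE.
rewrite !sumE.
elim/big_ind2 : _ => //.
- exact: is_diff_cst.
- by move=> g1 dg1 g2 dg2 d1 d2; exact: is_diffD.
Qed.

Let coord (i : 'I_n) : 'cV[K]_n -> K := fun y => y i 0.

Let is_diff_coord x (i : 'I_n) : is_diff x (coord i) (coord i).
Proof.
have lin : linear (coord i : 'cV[K]_n -> K^o).
  by move=> a u w; rewrite /coord !mxE.
(* A continuous linear map is its own differential. *)
pose coordM := GRing.isLinear.Build _ _ _ _ _ lin.
pose coordL : {linear _ -> _} := HB.pack (coord i : 'cV[K]_n -> K^o) coordM.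
apply: DiffDef; first exact: differentiable_coord.
exact: (@diff_lin _ _ _ coordL x (@coord_continuous _ _ _ i 0)).
Qed.

(** The form is a finite sum of products of coordinates, so the product rule applies term by
    term. *)
Lemma is_diff_qform M x :
  is_diff x (qform M) (fun v => bform M x v + bform M v x).
Proof.
have -> : qform M = (fun y => \sum_j \sum_i (M i j *: (coord i * coord j)) y).
  by apply/funext => y; rewrite qform_bform bformE.
have -> : (fun v => bform M x v + bform M v x) = (fun v => \sum_j \sum_i
    (M i j *: (coord i x *: coord j + coord j x *: coord i)) v).
  apply/funext => v; rewrite !bformE -big_split /=.
  apply: eq_bigr => j _; rewrite -big_split /=.
  by apply: eq_bigr => i _; rewrite -mulrDr [v i 0 * _]mulrC.
apply: is_diff_sum => j; apply: is_diff_sum => i; apply: is_diffZ.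
by apply: is_diffM; exact: is_diff_coord.
Qed.

Lemma diff_qform M x v : 'd (qform M) x v = bform M x v + bform M v x.
Proof. by have d := is_diff_qform M x; rewrite diff_val. Qed.

Lemma differentiable_qform M x : differentiable (qform M) x.
Proof. by have d := is_diff_qform M x; exact: ex_diff. Qed.

Lemma continuous_qform M : continuous (qform M).
Proof.
by move=> x; exact/differentiable_continuous/differentiable_qform.
Qed.

Lemma C1_qform M : C1_fun (qform M).
Proof.
split=> [x|v x]; first exact: differentiable_qform.
(* Polarization reduces continuity of the differential to that of the form. *)
have -> : (fun y => 'd (qform M) y v) =
    (fun y => qform M (y + v) - qform M y - qform M v).
  apply/funext => y; rewrite diff_qform !qform_bform bformDl !bformDr; ring.
have shiftc : {for x, continuous (fun y : 'cV[K]_n => qform M (y + v))}.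
  apply: (@continuous_comp _ _ _ (fun y : 'cV[K]_n => y + v) (qform M)).
    apply: continuousD; last exact: cst_continuous.
    exact: (@cvg_id _ (nbhs x)).
  exact: continuous_qform.
apply: (@cvgB _ _ _ (nbhs x) _
  (fun y => qform M (y + v) - qform M y) (fun=> qform M v)).
  exact: (cvgB shiftc (@continuous_qform M x)).
exact: cvg_cst.
Qed.

End QuadraticFormCalculus.

(** * Equivalence of the matrix inequality with dissipation *)

Section LinearMatrixInequality.
Variables (K : realType) (n m p : nat).
Variables (A : 'M[K]_n) (B : 'M[K]_(n, m)) (C : 'M[K]_(p, n)) (D : 'M[K]_(p, m)).
Variables (F : 'M[K]_(m, p)) (P Q : 'M[K]_n) (R : 'M[K]_m).
Hypotheses (Psym : P^T = P) (R_pd : posdefmx R).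
Hypothesis riccati :
  - (A^T *m P) - P *m A + P *m B *m invmx R *m B^T *m P = Q.

(* Completing the square in [R] turns the disturbance into
   [w - R^-1 (F D)^T B^T P x] in the dissipation inequality and the second block
   variable into [z + R^-1 (1 + F D)^T B^T P x] in the matrix inequality;
   [lmi_shift] is the resulting difference [w - z]. *)
Definition lmi_shift : 'M[K]_(m, n) :=
  invmx R *m (1%:M + (F *m D)^T *+ 2) *m B^T *m P.

Lemma qform_lmi x w :
  qform (lmi_mx B C D F P Q R) (col_mx x (w - lmi_shift *m x)) =
  qform R w - 'd (qform P) x (closed_loop A B C D F x w).
Proof.
have Rsym := R_pd.1; have Ru := posdefmx_unit R_pd.
(* Every term involving [B] becomes an [R]-product of two of [a], [c], [y] and the disturbance (or
   second block) variable. The remaining terms, in [P] and [A], come from the Riccati expression and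
   from the drift. *)
pose a := invmx R *m B^T *m P *m x.
pose c := invmx R *m (F *m D)^T *m B^T *m P *m x.
pose y := F *m C *m x.
have -> : lmi_shift *m x = a + c + c.
  by rewrite /lmi_shift mulmxDr mulmx1 mulr2n mulmxDr !mulmxDl addrA.
have symR u v : bform R u v = bform R v u by rewrite -bform_tr Rsym.
have Ra v : bform R a v = (x^T *m P *m B *m v) 0 0.
  rewrite symR -bform_tr Rsym /bform /a !trmx_mul trmxK trmx_inv Rsym Psym.
  by rewrite !mulmxA mulmxKV.
have Rc v : bform R c v = (x^T *m P *m B *m F *m D *m v) 0 0.
  rewrite symR -bform_tr Rsym /bform /c !trmx_mul !trmxK trmx_inv Rsym Psym.
  by rewrite !mulmxA mulmxKV.
have PA : bform (P *m A) x x = bform P x (A *m x).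
  by rewrite /bform !mulmxA.
have AP : bform (A^T *m P) x x = bform P x (A *m x).
  by rewrite -PA -[in RHS]bform_tr trmx_mul Psym.
have PBBP : bform (P *m B *m invmx R *m B^T *m P) x x = bform R a a.
  by rewrite Ra /bform /a !mulmxA.
have PBFC : bform (P *m B *m F *m C) x x = bform R a y.
  by rewrite Ra /bform /y !mulmxA.
have CFBP : bform (C^T *m F^T *m B^T *m P) x x = bform R a y.
  by rewrite -PBFC -bform_tr !trmx_mul !trmxK Psym !mulmxA.
have N : bform (lmi_N B D F P R) x x = bform R c a + bform R c a.
  have -> : lmi_N B D F P R = P *m B *m F *m D *m invmx R *m B^T *m P +
      (P *m B *m F *m D *m invmx R *m B^T *m P)^T.
    rewrite /lmi_N !trmx_mul trmxK trmx_inv Rsym Psym mulmxDr !mulmxDl.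
    by rewrite !mulmxA.
  by rewrite bformDm bform_tr Rc /bform /a !mulmxA.
have PBbar z : bform (P *m lmi_Bbar B D F) x z = bform R a z + bform R c z.
  by rewrite Ra Rc /bform /lmi_Bbar !mulmxDr mulmx1 !mulmxDl !mulmxA !mxE.
have BbarP z : bform ((lmi_Bbar B D F)^T *m P) z x = bform R a z + bform R c z.
  by rewrite -PBbar -bform_tr trmx_mul trmxK Psym.
have PBF v : bform P x (B *m F *m v) = bform R a (F *m v).
  by rewrite Ra /bform !mulmxA.
have symP u v : bform P u v = bform P v u by rewrite -bform_tr Psym.
have cl : bform P x (closed_loop A B C D F x w) =
    bform P x (A *m x) + bform R a y + bform R c w.
  rewrite /closed_loop mulmxDl !bformDr Ra Rc /bform /y.
  by rewrite !mulmxA.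
rewrite diff_qform (symP _ x) cl /lmi_mx qform_block BbarP PBbar.
rewrite !qform_bform !(bformDm, bformNm) CFBP PBFC N.
rewrite -riccati !(bformDm, bformNm) AP PA PBBP.
rewrite !(bformDl, bformDr, bformNl, bformNr).
(* Symmetric products are put in one order, so that [ring] sees equal atoms. *)
rewrite (symR c a) (symR w a) (symR w c).
ring.
Qed.

(** The map sending [(x, w)] to [(x, w - lmi_shift *m x)] is a linear bijection, so by [qform_lmi]
    positivity off the origin transfers both ways. *)
Lemma lmi_dissipativeE :
  posdefmx (lmi_mx B C D F P Q R) <->
  forall x w, ~ (x = 0 /\ w = 0) ->
    'd (qform P) x (closed_loop A B C D F x w) < qform R w.
Proof.
split=> [[_ Lpos] x w xw|dV].
  rewrite -subr_gt0 -qform_lmi; apply: Lpos; apply/eqP => /eqP.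
  rewrite col_mx_eq0 => /andP[/eqP x0]; rewrite x0 mulmx0 subr0 => /eqP w0.
  exact: xw.
have Rsym := R_pd.1.
have trD (k : nat) (X Y : 'M[K]_k) : (X + Y)^T = X^T + Y^T by rewrite linearD.
have trN (X : 'M[K]_n) : (- X)^T = - X^T by rewrite linearN.
(* Positive definiteness includes symmetry of the block matrix, checked block by block. *)
split.
  rewrite /lmi_mx tr_block_mx Rsym; congr block_mx; last first.
  - by rewrite trmx_mul Psym.
  - by rewrite trmx_mul trmxK Psym.
  have trPA : (P *m A)^T = A^T *m P by rewrite trmx_mul Psym.
  have trAP : (A^T *m P)^T = P *m A by rewrite trmx_mul trmxK Psym.
  have trPBBP : (P *m B *m invmx R *m B^T *m P)^T = P *m B *m invmx R *m B^T *m P.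
    by rewrite !trmx_mul trmxK trmx_inv Rsym Psym !mulmxA.
  have trPBFC : (P *m B *m F *m C)^T = C^T *m F^T *m B^T *m P.
    by rewrite !trmx_mul Psym !mulmxA.
  have trN' : (lmi_N B D F P R)^T = lmi_N B D F P R.
    rewrite /lmi_N !trmx_mul trD !trmx_mul !trmxK trmx_inv Rsym Psym.
    by rewrite [invmx R *m _ + _]addrC !mulmxA.
  rewrite -riccati !(trD, trN) trN' -trPBFC trmxK trPA trAP trPBBP.
  by rewrite [- (P *m A) - _]addrC [_ - _ - P *m B *m F *m C]addrAC.
move=> u; rewrite -[u]vsubmxK; set x := usubmx u; set z := dsubmx u => xz.
(* The disturbance matching the second block [z] is [z + lmi_shift *m x]. *)
rewrite -[z](addrK (lmi_shift *m x)) qform_lmi subr_gt0.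
apply: dV => -[x0 w0]; move: xz; move: w0.
by rewrite x0 mulmx0 addr0 => ->; rewrite col_mx0 eqxx.
Qed.

End LinearMatrixInequality.

(** * Comparison of quadratic forms with the squared norm *)

Section QuadraticFormBounds.
Variable K : realType.

Lemma continuous_trmx m n : continuous (@trmx K m n).
Proof.
move=> x s /nbhs_ballP[e e0 es].
apply/nbhs_ballP; exists e => //= y [_ xy]; apply: es.
by split=> // i j; rewrite !mxE.
Qed.

Lemma ler_norm_mx m n (M : 'M[K]_(m, n)) (r : K) :
  0 <= r -> (`|M| <= r) = [forall i, forall j, `|M i j| <= r].
Proof.
move=> r0; rewrite {1}/Num.norm/= mx_normrE; apply/bigmax_leP/idP.
  move=> [_ Mr]; apply/forallP => i; apply/forallP => j; exact: (Mr (i, j)).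
by move=> /forallP Mr; split=> // -[i j] _; exact: (forallP (Mr i)).
Qed.

(** The norm is the largest absolute value of an entry. *)
Lemma norm_trmx m n (M : 'M[K]_(m, n)) : `|M^T| = `|M|.
Proof.
have le_tr p q (N : 'M[K]_(p, q)) : `|N^T| <= `|N|.
  rewrite ler_norm_mx//; apply/forallP => i; apply/forallP => j; rewrite mxE.
  have := lexx `|N|; rewrite {1}ler_norm_mx// => /forallP/(_ j)/forallP; exact.
by apply/le_anti; rewrite le_tr -{1}[M]trmxK le_tr.
Qed.

(** The constant is the minimum of the form on the unit sphere, extended by homogeneity. The bound
    assumes no sign of [M], so it can also be applied to [- M]. *)
Lemma qform_sphere_min n (M : 'M[K]_n) :
  exists c : K, (forall x, c * `|x| ^+ 2 <= qform M x) /\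
    ((forall x, x != 0 -> 0 < qform M x) -> 0 < c).
Proof.
have [[x0 x0_neq0]|no_x] := pselect (exists x : 'cV[K]_n, x != 0); last first.
  (* In dimension zero the sphere is empty and any positive constant works. *)
  exists 1; split=> // x; have [->|x_neq0] := eqVneq x 0.
    by rewrite normr0 qform0 mul1r expr0n.
  by case: no_x; exists x.
(* The sphere consists of row vectors, to which [bounded_closed_compact] applies; transposition
   carries the result back to columns. *)
pose S := [set v : 'rV[K]_n | `|v| = 1]%classic.
have unitS (x : 'cV[K]_n) : x != 0 -> S (`|x|^-1 *: x)^T.
  move=> x_neq0; rewrite /S/= norm_trmx normrZ normfV normr_id mulVf//.
  by rewrite normr_eq0.
have cS : compact S.
  apply: bounded_closed_compact.
    exists 1; split=> [|r r1 v]; first exact: num_real.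
    by rewrite /S/= => ->; exact: ltW.
  have -> : S = (Num.norm @^-1` [set 1 : K])%classic by [].
  apply: preimage_closed; last exact: closed_eq.
  by move=> v _; exact: norm_continuous.
have cq : continuous (fun v : 'rV[K]_n => qform M v^T).
  move=> v; apply: (@continuous_comp _ _ _ trmx (qform M)).
    exact: continuous_trmx.
  exact: continuous_qform.
have [c cinS cmin] := compact_EVT_min
  (ex_intro _ _ (unitS _ x0_neq0)) cS (continuous_subspaceT cq).
exists (qform M c^T); split=> [x|Mpos].
  have [->|x_neq0] := eqVneq x 0; first by rewrite normr0 qform0 expr0n mulr0.
  have xn : `|x| != 0 by rewrite normr_eq0.
  have := cmin _ (mem_set (unitS _ x_neq0)); rewrite trmxK qformZ.
  rewrite exprVn ler_pdivlMl ?exprn_gt0 ?normr_gt0//.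
  by rewrite mulrC.
apply: Mpos; rewrite -normr_eq0 norm_trmx.
by move: cinS; rewrite inE /S/= => ->; exact: oner_neq0.
Qed.

Lemma posdefmx_norm_bounds n (M : 'M[K]_n) : posdefmx M ->
  exists2 a : K, 0 < a & exists2 b : K, 0 < b &
    forall x, a * `|x| ^+ 2 <= qform M x <= b * `|x| ^+ 2.
Proof.
move=> [_ Mpos]; have [a [Ma /(_ Mpos) a0]] := qform_sphere_min M.
have [c [Mc _]] := qform_sphere_min (- M).
(* The bound for [- M] gives the upper constant [- c]; enlarging it to [|c| + 1] makes it
   positive. *)
exists a => //; exists (`|c| + 1); first by rewrite ltr_wpDl.
move=> x; rewrite Ma /=; have := Mc x; rewrite qformN => Mcx.
have x2 : 0 <= `|x| ^+ 2 by rewrite exprn_ge0.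
have : - c * `|x| ^+ 2 <= `|c| * `|x| ^+ 2.
  by apply: ler_wpM2r => //; rewrite -normrN ler_norm.
move: (`|x| ^+ 2) x2 Mcx => s; lra.
Qed.

End QuadraticFormBounds.

(** * Lyapunov stability with an exponential rate *)

Section Lyapunov.
Variables (K : realType) (n : nat) (M P : 'M[K]_n).
Hypothesis P_pd : posdefmx P.
Hypothesis decrease : forall x, x != 0 -> 'd (qform P) x (M *m x) < 0.

Lemma lyapunov_decay_rate :
  exists2 k : K, 0 < k & forall x, 'd (qform P) x (M *m x) <= - k * qform P x.
Proof.
(* The form of [N] is minus the derivative of the Lyapunov function along the flow. *)
pose N := - (P *m M + M^T *m P).
have NE x : qform N x = - 'd (qform P) x (M *m x).
  rewrite qformN diff_qform qform_bform bformDm /bform trmx_mul.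
  by rewrite !mulmxA.
have [c [Nc c_gt0]] := qform_sphere_min N.
have {}c_gt0 : 0 < c.
  by apply: c_gt0 => x x0; rewrite NE oppr_gt0 decrease.
have [a a0 [b b0 Pab]] := posdefmx_norm_bounds P_pd.
(* The decrease is at least [c] times the squared norm, which is at least [qform P x / b]. *)
exists (c / b); first by rewrite divr_gt0.
move=> x; rewrite mulNr lerNr -NE (le_trans _ (Nc x))//.
rewrite -mulrA ler_pM2l// mulrC ler_pdivrMr// mulrC.
by have /andP[] := Pab x.
Qed.

Lemma is_derive_qform_trajectory (x : K -> 'cV[K]_n) (t : K) (v : 'cV[K]_n) :
  is_derive t 1 x v -> is_derive t 1 (qform P \o x) ('d (qform P) (x t) v).
Proof.
move=> dx; have dfx : differentiable x t.
  by apply/derivable1_diffP; exact: ex_derive.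
have dVx : differentiable (qform P \o x) t.
  by apply: differentiable_comp => //; exact: differentiable_qform.
apply: DeriveDef; first exact/derivable1_diffP.
rewrite deriveE// diff_comp//; last exact: differentiable_qform.
by rewrite /= -(deriveE _ dfx) derive_val.
Qed.

(** The product of [expR (k * t)] and [qform P (x t)] has nonpositive derivative for positive [t];
    continuity on the closed half-line brings the comparison down to time 0. *)
Lemma lyapunov_decay (k : K) :
  (forall x, 'd (qform P) x (M *m x) <= - k * qform P x) ->
  forall x, trajectory (fun _ z => M *m z) x ->
  forall t, 0 <= t -> expR (k * t) * qform P (x t) <= qform P (x 0).
Proof.
move=> rate x [cx dx] t t0.
pose g : K -> K := (fun s => expR (k * s)) * (qform P \o x).
have dexp (s : K) : is_derive s 1 (fun s => expR (k * s)) (k * expR (k * s)).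
  have d : is_derive s 1 (fun s => k * s) (k * 1) by exact: is_deriveZ.
  have := @is_derive1_comp _ expR (fun s => k * s) s _ _ (is_derive_expR _) d.
  by rewrite mulr1 mulrC.
have dg (s : K) : 0 < s -> is_derive s 1 g
    (expR (k * s) *: 'd (qform P) (x s) (M *m x s) +
     (qform P (x s)) *: (k * expR (k * s))).
  by move=> s0; apply: is_deriveM; exact/is_derive_qform_trajectory/dx.
have gE s : g s = expR (k * s) * qform P (x s) by [].
have -> : qform P (x 0) = g 0.
  by rewrite gE mulr0 expR0 mul1r.
rewrite -gE; apply: (@ler0_derive1_nincry _ g 0) => //.
- move=> s; rewrite in_itv/= andbT => s0.
  by have ds := dg _ s0; exact: ex_derive.
- move=> s; rewrite in_itv/= andbT => s0; rewrite derive1E.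
  have ds := dg _ s0; rewrite derive_val /GRing.scale/=.
  have := rate (x s); have := expR_gt0 (k * s).
  move: (expR _) (qform _ _) ('d _ _ _) => e q d e0 dq.
  have : e * d <= e * (- k * q) by rewrite ler_pM2l.
  move: (e * d) => ed; lra.
- have cV : {within `[0, +oo[, continuous (qform P \o x)}%classic.
    move=> s; exact: (cvg_comp _ _ (cx s) (@continuous_qform _ _ P (x s))).
  have ce : {within `[0, +oo[, continuous (fun s : K => expR (k * s))}%classic.
    apply: continuous_subspaceT => s.
    apply: differentiable_continuous; apply/derivable1_diffP.
    by have d := dexp s; exact: ex_derive.
  by move=> s; exact: (cvgM (ce s) (cV s)).
Qed.

Lemma lyapunov_asymptotically_stable : asymptotically_stable M.
Proof.
have [k k0 rate] := lyapunov_decay_rate.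
have [a a0 [b b0 Pab]] := posdefmx_norm_bounds P_pd.
(* The norm bounds on [P] turn decay of the form into decay of the norm. *)
have bound x : trajectory (fun _ z => M *m z) x -> forall t, 0 <= t ->
    expR (k * t) * `|x t| ^+ 2 <= b / a * `|x 0| ^+ 2.
  move=> trx t t0; have := lyapunov_decay rate trx t0.
  have /andP[_ Pb] := Pab (x 0); have /andP[Pa _] := Pab (x t).
  have e0 := expR_gt0 (k * t).
  move=> decay; rewrite mulrAC ler_pdivlMr// -mulrA [_ * a]mulrC.
  by rewrite (le_trans _ (le_trans decay Pb))// ler_pM2l.
split=> [e e0|x trx].
  (* Chosen so that its square times [b / a] is [e ^+ 2]. *)
  exists (e * Num.sqrt (a / b)).
    by rewrite mulr_gt0// sqrtr_gt0 divr_gt0.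
  move=> x trx xd t t0; rewrite -(@ltr_pXn2r _ 2)// ?nnegrE ?(ltW e0)//.
  have et : 1 <= expR (k * t) by rewrite -expR0 ler_expR mulr_ge0// ltW.
  have : `|x t| ^+ 2 <= expR (k * t) * `|x t| ^+ 2.
    by rewrite ler_peMl// exprn_ge0.
  move=> /le_trans/(_ (bound x trx t t0))/le_lt_trans; apply.
  rewrite mulrC -ltr_pdivlMr ?divr_gt0// invf_div.
  have -> : e ^+ 2 * (a / b) = (e * Num.sqrt (a / b)) ^+ 2.
    by rewrite exprMn sqr_sqrtr// divr_ge0// ltW.
  by rewrite ltr_pXn2r// ?nnegrE ?mulr_ge0 ?sqrtr_ge0 ?(ltW e0).
apply/cvgr0Pnorm_lt => e e0; near=> t.
have t0 : 0 <= t by near: t; apply: nbhs_pinfty_ge; exact: num_real.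
rewrite -(@ltr_pXn2r _ 2)// ?nnegrE ?(ltW e0)//.
have e20 : 0 < e ^+ 2 by rewrite exprn_gt0.
rewrite -(ltr_pM2l (expR_gt0 (k * t))).
apply: le_lt_trans (bound x trx t t0) _.
(* Since [expR (k * t)] is at least [1 + k * t], an explicit lower bound on [t] suffices. *)
rewrite -ltr_pdivrMr//; apply: lt_le_trans (expR_ge1Dx _).
rewrite -ltrBlDl -ltr_pdivrMl//.
by near: t; apply: nbhs_pinfty_gt; exact: num_real.
Unshelve. all: by end_near. Qed.

End Lyapunov.

Theorem mainTheorem2 (K : realType) (n m p : nat)
    (A : 'M[K]_n) (B : 'M[K]_(n, m)) (C : 'M[K]_(p, n)) (D : 'M[K]_(p, m))
    (AB_ctrl : controllable A B) (AC_obs : observable A C)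
    (Q sqrtQ : 'M[K]_n) (R : 'M[K]_m)
    (Q_psd : possemidefmx Q) (R_pd : posdefmx R)
    (sqrtQ_def : is_sqrtmx sqrtQ Q) (AQ_obs : observable A sqrtQ) :
  (forall P : 'M[K]_n,
     posdefmx P ->
     - (A^T *m P) - P *m A + P *m B *m invmx R *m B^T *m P = Q ->
     forall F : 'M[K]_(m, p),
       posdefmx (lmi_mx B C D F P Q R) ->
       stabilizing A B C F /\
       quadratically_dissipative (closed_loop A B C D F) (qform R))
  /\
  ((exists F : 'M[K]_(m, p),
      stabilizing A B C F /\
      quadratically_dissipative (closed_loop A B C D F) (qform R)) ->
   exists (F : 'M[K]_(m, p)) (P Q' : 'M[K]_n) (R' : 'M[K]_m),
     [/\ posdefmx P, posdefmx R', Q'^T = Q' &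
         posdefmx (lmi_mx B C D F P Q' R')]).
Proof.
split=> [P P_pd riccati F|[F [_ [_ [V [[P [Psym ->]] [_ [_ P_pos] dV]]]]]]].
  move=> /(lmi_dissipativeE C D F P_pd.1 R_pd riccati) dV.
  split; last first.
    split; first by exists R; split=> //; exact: R_pd.1.
    exists (qform P); split; first by exists P; split=> //; exact: P_pd.1.
    split=> //; first exact: C1_qform.
    by split; [exact: qform0 | exact: P_pd.2].
  (* Dissipation at [w = 0] is strict decrease of the storage function. *)
  apply: (lyapunov_asymptotically_stable P_pd) => x x0.
  have := dV x 0; rewrite /closed_loop mulmx0 addr0 qform0; apply.
  by move=> [/eqP]; rewrite (negbTE x0).
(* This [Q'] makes the Riccati equation hold by reflexivity. *)
exists F, P, (- (A^T *m P) - P *m A + P *m B *m invmx R *m B^T *m P), R.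
have L_pd := (lmi_dissipativeE C D F Psym R_pd erefl).2 dV.
split=> //.
have [Rsym _] := R_pd.
(* Symmetry of [Q']: transposition swaps its first two terms and fixes the third. *)
rewrite !(linearD, linearN) /= !trmx_mul !trmxK trmx_inv Rsym Psym !mulmxA.
by rewrite [- (P *m A) - _]addrC.
Qed.
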